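(* For every field $\mathbb{F}$ of characteristic different from $2$ and $3$, there exists an infinite-dimensional $2$-generated primitive axial algebra of Monster type $(2,\frac{1}{2})$ over $\mathbb{F}$.
   Context: Let $\mathbb{F}$ be a field and $\mathcal{S}$ a finite subset of $\mathbb{F}$ with $1\in\mathcal{S}$. A fusion law on $\mathcal{S}$ is a map $\star:\mathcal{S}\times\mathcal{S}\to 2^{\mathcal{S}}$. An axial algebra over $\mathbb{F}$ with spectrum $\mathcal{S}$ and fusion law $\star$ is a commutative, not necessarily associative $\mathbb{F}$-algebra $V$ generated (as an algebra) by a set $\mathcal{A}$ of nonzero idempotents, called axes, such that for each $a\in\mathcal{A}$: (Ax1) $\mathrm{ad}_a:v\mapsto av$ is a semisimple (i.e. diagonalizable) endomorphism of $V$ with spectrum contained in $\mathcal{S}$; (Ax2) for all $\lambda,\mu\in\mathcal{S}$, the product of a $\lambda$-eigenvector and a $\mu$-eigenvector of $\mathrm{ad}_a$ is a sum of $\delta$-eigenvectors of $\mathrm{ad}_a$ with $\delta\in\lambda\star\mu$ (an empty sum being $0$). $V$ is primitive if moreover, for each $a\in\mathcal{A}$, (Ax3) the $1$-eigenspace of $\mathrm{ad}_a$ is $V_1=\langle a\rangle$. For $\alpha,\beta\in\mathbb{F}\setminus\{0,1\}$ with $\alpha\ne\beta$, the fusion law $\mathcal{M}(\alpha,\beta)$ on $\{1,0,\alpha,\beta\}$ is the symmetric law given by $1\star1=\{1\}$, $1\star0=\emptyset$, $1\star\alpha=\{\alpha\}$, $1\star\beta=\{\beta\}$, $0\star0=\{0\}$,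 $0\star\alpha=\{\alpha\}$, $0\star\beta=\{\beta\}$, $\alpha\star\alpha=\{1,0\}$, $\alpha\star\beta=\{\beta\}$, $\beta\star\beta=\{1,0,\alpha\}$. An axial algebra of Monster type $(\alpha,\beta)$ is an axial algebra with spectrum $\{1,0,\alpha,\beta\}$ and fusion law $\mathcal{M}(\alpha,\beta)$. It is $2$-generated if it is generated as an algebra by two axes, i.e. the generating set $\mathcal{A}$ of axes can be taken to have two elements. *)

(* Defs.v *)
From HB Require Import structures.
From mathcomp Require Import all_boot all_order all_algebra.

Set Implicit Arguments.
Unset Strict Implicit.
Unset Printing Implicit Defensive.

Import GRing.Theory.
Local Open Scope ring_scope.

(* The algebra structures of ssralg are all associative and unital, so an
   algebra in the wide sense is a module together with a bilinear product. *)
Record commNaAlgebra (F : fieldType) := CommNaAlgebra {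
  na_sort :> lmodType F;
  na_mul : {bilinear na_sort -> na_sort -> na_sort};
  na_mulC : commutative na_mul
}.

(* The finite sets S and lam * mu are given by sequences, of which only the
   membership predicate is ever used. The values of star outside of
   S x S are irrelevant. *)
Record fusionLaw (F : fieldType) := FusionLaw {
  spectrum : seq F;
  star : F -> F -> seq F;
  spectrum1 : 1 \in spectrum;
  star_spectrum : forall lam mu, lam \in spectrum -> mu \in spectrum ->
    {subset star lam mu <= spectrum}
}.

Section AxialAlgebra.

Variables (F : fieldType) (V : commNaAlgebra F).
Implicit Types (a u v : V) (A : V -> Prop) (P : F -> Prop) (L : fusionLaw F).

Definition finite_dimensional : Prop :=
  exists (n : nat) (e : 'I_n -> V),
    forall v, exists c : 'I_n -> F, v = \sum_(i < n) c i *: e i.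

(* Subalgebras need not contain a unit. *)
Inductive generated A : V -> Prop :=
| generated_mem v : A v -> generated A v
| generated0 : generated A 0
| generatedP (c : F) u v :
    generated A u -> generated A v -> generated A (c *: u + v)
| generatedM u v :
    generated A u -> generated A v -> generated A (na_mul V u v).

(* The zero vector is included. *)
Definition in_eigenspace a (lam : F) v : Prop := na_mul V a v = lam *: v.

Definition ad_eigenvalue a (lam : F) : Prop :=
  exists2 v, v != 0 & in_eigenspace a lam v.

Definition eigen_sum a P v : Prop :=
  exists2 s : seq V,
    forall x, x \in s -> exists2 lam, P lam & in_eigenspace a lam x &
    v = \sum_(x <- s) x.

Definition ad_diagonalizable a : Prop :=
  forall v, eigen_sum a (fun _ => True) v.

Definition is_axis L a : Prop :=
  [/\ a != 0 /\ na_mul V a a = a,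
      ad_diagonalizable a,
      forall lam, ad_eigenvalue a lam -> lam \in spectrum L
    & forall lam mu u v, lam \in spectrum L -> mu \in spectrum L ->
        in_eigenspace a lam u -> in_eigenspace a mu v ->
        eigen_sum a (fun del => del \in star L lam mu) (na_mul V u v)].

Definition axial_algebra L A : Prop :=
  (forall a, A a -> is_axis L a) /\ (forall v, generated A v).

Definition primitive_axis a : Prop :=
  forall v, in_eigenspace a 1 v <-> exists c : F, v = c *: a.

Definition primitive_axial_algebra L A : Prop :=
  axial_algebra L A /\ (forall a, A a -> primitive_axis a).

Definition two_generated_primitive L : Prop :=
  exists a b : V,
    a != b /\ primitive_axial_algebra L (fun x => x = a \/ x = b).

End AxialAlgebra.

Section MonsterLaw.

Variables (F : fieldType) (alpha beta : F).

Definition monster_spectrum : seq F := [:: 1; 0; alpha; beta].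

(* Off the spectrum the value is the junk value [::]. *)
Definition monster_star (lam mu : F) : seq F :=
  let p := (lam, mu) in
  if p == (1, 1) then [:: 1]
  else if p \in [:: (1, 0); (0, 1)] then [::]
  else if p \in [:: (1, alpha); (alpha, 1)] then [:: alpha]
  else if p \in [:: (1, beta); (beta, 1)] then [:: beta]
  else if p == (0, 0) then [:: 0]
  else if p \in [:: (0, alpha); (alpha, 0)] then [:: alpha]
  else if p \in [:: (0, beta); (beta, 0)] then [:: beta]
  else if p == (alpha, alpha) then [:: 1; 0]
  else if p \in [:: (alpha, beta); (beta, alpha)] then [:: beta]
  else if p == (beta, beta) then [:: 1; 0; alpha]
  else [::].

Lemma monster_spectrum1 : 1 \in monster_spectrum.
Proof. exact: mem_head. Qed.

Lemma monster_star_spectrum (lam mu : F) :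
  lam \in monster_spectrum -> mu \in monster_spectrum ->
  {subset monster_star lam mu <= monster_spectrum}.
Proof.
move=> _ _; apply/allP; rewrite /monster_star.
by do ![case: ifP => _]; rewrite //= !inE !eqxx ?orbT.
Qed.

Definition monster_law : fusionLaw F :=
  FusionLaw monster_spectrum1 monster_star_spectrum.

(* These conditions make the four elements of the spectrum distinct, so that
   the table defining monster_star is unambiguous. *)
Definition monster_parameters : Prop :=
  [/\ alpha \notin [:: 0; 1], beta \notin [:: 0; 1] & alpha != beta].

Definition two_generated_primitive_monster (V : commNaAlgebra F) : Prop :=
  monster_parameters /\ two_generated_primitive V monster_law.

End MonsterLaw.

(* Main.v *)
Require Import Defs.
From HB Require Import structures.
From mathcomp Require Import all_boot all_order all_algebra ring.

(* The example is the Highwater algebra, with basis a_i (i in Z), s_j (j > 0) and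
     a_i a_j = (a_i + a_j) / 2 + s_|i-j|,
     a_i s_j = 3/8 (a_(i-j) + a_(i+j) - 2 a_i) + 3/2 s_j,
     s_i s_j = 3/4 (s_i + s_j) - 3/8 (s_|i-j| + s_(i+j)),   s_0 = 0.
   Read a_i as the Laurent monomial t^i and s_j as z_j = t^j + t^-j - 2.  With
   eps p = p(1) and pbar(t) = p(1/t), the products become
     p . p' = (eps(p') p + eps(p) p') / 2
                + (p pbar' + pbar p' - 2 eps(p) eps(p')),
     p . z  = 3/8 p z + 3/2 eps(p) z,        z . z' = - 3/8 z z'.
   Put X = (t + 1/t - 2) / 2.  Laurent polynomials are free over F[X] on 1, t,
   and the symmetric ones vanishing at t = 1 form the ideal X F[X] of F[X].
   Hence (u, v, w) |-> (u + v t, 4 X w) identifies F[X]^3 with the algebra.  The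
   generating axes are (1, 0, 0) and (0, 1, 0); exchanging u and v, that is
   t^i |-> t^(1-i), is an automorphism that swaps them, so only the first one
   has to be examined.  Its eigenvectors for 0, 2, 1/2 are (-3Xp, 0, p),
   (Xp, 0, p) and (-(1+X)p, p, 0), and the fusion law is read off from the
   products of these three families. *)

Set Implicit Arguments.
Unset Strict Implicit.
Unset Printing Implicit Defensive.

Import GRing.Theory.
Local Open Scope ring_scope.

(** * Sums of eigenvectors and generated subalgebras *)

Section CommNaAlgebra.

Variables (F : fieldType) (V : commNaAlgebra F).
Implicit Types (a u v : V) (A : V -> Prop) (P : F -> Prop) (L : fusionLaw F).

Lemma eigen_sum0 a P : eigen_sum a P 0.
Proof. by exists [::]; rewrite ?big_nil. Qed.

Lemma eigen_sum1 a P lam v : P lam -> in_eigenspace a lam v -> eigen_sum a P v.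
Proof.
move=> Plam av; exists [:: v]; last by rewrite big_seq1.
by move=> x; rewrite inE => /eqP->; exists lam.
Qed.

Lemma eigen_sumD a P u v :
  eigen_sum a P u -> eigen_sum a P v -> eigen_sum a P (u + v).
Proof.
move=> [s sP ->] [t tP ->]; exists (s ++ t); last by rewrite big_cat.
by move=> x; rewrite mem_cat => /orP[/sP|/tP].
Qed.

Lemma eigen_sumZ a P c v : eigen_sum a P v -> eigen_sum a P (c *: v).
Proof.
move=> [s sP ->]; exists [seq c *: x | x <- s].
  move=> _ /mapP[x /sP[lam Plam ax] ->]; exists lam => //.
  by rewrite /in_eigenspace linearZr_LR ax !scalerA mulrC.
by rewrite big_map scaler_sumr.
Qed.

Lemma generatedZ A c v : generated A v -> generated A (c *: v).
Proof.
move=> Av; rewrite -[_ *: v]addr0; apply: generatedP => //.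
exact: generated0.
Qed.

Lemma generatedD A u v : generated A u -> generated A v -> generated A (u + v).
Proof. by move=> Au Av; rewrite -[u]scale1r; apply: generatedP. Qed.

(** * Transport of axes along an involutive automorphism *)

Section Automorphism.

Variable f : {linear V -> V}.
Hypotheses (fK : involutive f) (fM : {morph f : u v / na_mul V u v}).

(** As [f] is its own inverse, a condition on [f a] at [v] becomes one on [a] at [f v]; the axis
    properties below are carried over in this way. *)
Lemma in_eigenspace_aut a lam v :
  in_eigenspace (f a) lam v <-> in_eigenspace a lam (f v).
Proof.
split=> av; apply: (can_inj fK); first by rewrite fM fK av linearZ fK.
by rewrite fM fK av linearZ.
Qed.

Lemma eigen_sum_aut a P v : eigen_sum a P (f v) -> eigen_sum (f a) P v.
Proof.
move=> [s sP fv]; exists [seq f x | x <- s].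
  move=> _ /mapP[x /sP[lam Plam ax] ->]; exists lam => //.
  by apply/in_eigenspace_aut; rewrite fK.
by rewrite big_map -linear_sum -fv fK.
Qed.

Lemma is_axis_aut L a : is_axis L a -> is_axis L (f a).
Proof.
move=> [[a0 aa] adiag aspec afus]; split.
- split; last by rewrite -fM aa.
  by apply: contra_neq a0 => fa0; rewrite -(fK a) fa0 linear0.
- by move=> v; apply/eigen_sum_aut.
- move=> lam [v v0 /in_eigenspace_aut av]; apply: aspec; exists (f v) => //.
  by apply: contra_neq v0 => fv0; rewrite -(fK v) fv0 linear0.
move=> lam mu u v lamL muL /in_eigenspace_aut au /in_eigenspace_aut av.
by apply: eigen_sum_aut; rewrite fM; apply: afus.
Qed.

Lemma primitive_axis_aut a : primitive_axis a -> primitive_axis (f a).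
Proof.
move=> ap v; rewrite in_eigenspace_aut ap.
split=> -[c vE]; exists c; last by rewrite vE linearZ /= fK.
by rewrite -linearZ -vE fK.
Qed.

End Automorphism.

End CommNaAlgebra.

(** * Constant term of a polynomial and quotient by X *)

Section ShiftPoly.

Variable F : fieldType.
Implicit Types p q : {poly F}.

Lemma horner1 c : (1 : {poly F}).[c] = 1.
Proof. exact: hornerC. Qed.

Definition hornerSE :=
  (horner0, horner1, hornerX, hornerC, hornerD, hornerN, hornerM, hornerMn).

Lemma drop_poly1MX p : drop_poly 1 ('X * p) = p.
Proof. by rewrite mulrC (drop_polyMXn_id 1). Qed.

Lemma drop_poly1C c : drop_poly 1 (c%:P : {poly F}) = 0.
Proof. by rewrite drop_poly_eq0 // size_polyC_leq1. Qed.

(** [drop_poly 1 p] is (p - p(0)) / X. Since X vanishes at t = 1, p(0) is the value eps; subtracting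
    it leaves a multiple of X, which explains the [drop_poly] term in the third coordinate of the
    product. *)
Lemma drop_poly1E p : p = p.[0]%:P + 'X * drop_poly 1 p.
Proof.
rewrite -{1}(poly_take_drop 1 p) mulrC; congr (_ + _).
by rewrite horner_coef0 /take_poly poly_def big_ord1 expr0 alg_polyC.
Qed.

Lemma poly_addCMX_inj c d p q :
  c%:P + 'X * p = d%:P + 'X * q -> c = d /\ p = q.
Proof.
move=> e; split; first by have := congr1 (horner^~ 0) e; rewrite !hornerE.
have := congr1 (drop_poly 1) e.
by rewrite !drop_polyD !drop_poly1C !drop_poly1MX !add0r.
Qed.

End ShiftPoly.

(** * Table of the Monster fusion law *)

Section MonsterLaw.

Variables (F : fieldType) (alpha beta : F).

Lemma monster_starC lam mu :
  monster_star alpha beta lam mu = monster_star alpha beta mu lam.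
Proof.
rewrite /monster_star !inE !xpair_eqE.
by do 2![case: (_ == 1); case: (_ == 0); case: (_ == alpha); case: (_ == beta)].
Qed.

(** Distinctness of the four eigenvalues decides every test in the table. Half of the table is
    enough, the law being symmetric; the row of 1 is uniform except at 0. *)
Lemma monster_starE : monster_parameters alpha beta ->
  let star := monster_star alpha beta in
  [/\ star 0 0 = [:: 0], star 0 alpha = [:: alpha], star 0 beta = [:: beta]
    & [/\ star alpha alpha = [:: 1; 0], star alpha beta = [:: beta],
      star beta beta = [:: 1; 0; alpha]
    & {in monster_spectrum alpha beta, forall lam,
        star 1 lam = if lam == 0 then [::] else [:: lam]}]].
Proof.
case; rewrite !inE !negb_or => /andP[/negbTE a0 /negbTE a1].
move=> /andP[/negbTE b0 /negbTE b1] /negbTE ab star.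
have n10 := negbTE (oner_neq0 F).
(* The tests compare the eigenvalues in either order, so each disequality is recorded both ways. *)
have sym (x y : F) : (x == y) = false -> (y == x) = false by rewrite eq_sym.
have neq := (a0, a1, b0, b1, ab, n10,
  sym _ _ a0, sym _ _ a1, sym _ _ b0, sym _ _ b1, sym _ _ ab, sym _ _ n10).
split; last split;
  try by rewrite /star /monster_star !(inE, xpair_eqE, eqxx, neq).
move=> lam; rewrite !inE => /or4P[]/eqP->.
all: by rewrite /star /monster_star !(inE, xpair_eqE, eqxx, neq).
Qed.

End MonsterLaw.

(** * The Highwater product on triples of polynomials *)

Section Highwater.

Variable F : fieldType.

Let P3 : lmodType F := ({poly F} * {poly F} * {poly F})%type.
Implicit Types (x y : P3) (p q u v w : {poly F}).

(* Twice the product, so that all the coefficients are integers. *)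
Definition hw_mul2 x y : P3 :=
  let: (u, v, w) := x in
  let: (u', v', w') := y in
  let e := (u.[0] + v.[0])%:P in
  let e' := (u'.[0] + v'.[0])%:P in
  (e' * u + e * u' + 3 * 'X * (u * w' + u' * w),
   e' * v + e * v' + 3 * 'X * (v * w' + v' * w),
   drop_poly 1 ((u + v) * (u' + v')) + (u * v' + v * u')
     + 3 * (e * w' + e' * w) - 3 * 'X * w * w').

Definition hw_mul x y : P3 := 2^-1 *: hw_mul2 x y.

Lemma hw_mul2C : commutative hw_mul2.
Proof.
move=> [[u v] w] [[u' v'] w'] /=; congr (_, _, _); try by ring.
by rewrite [(u + v) * _]mulrC; ring.
Qed.

Lemma hw_mulC : commutative hw_mul.
Proof. by move=> x y; rewrite /hw_mul hw_mul2C. Qed.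

Lemma hw_mul_linear x : linear (hw_mul x).
Proof.
move=> c y z; rewrite /hw_mul scalerA mulrC -scalerA -scalerDr.
congr (_ *: _); case: x y z => [[u v] w] [[u' v'] w'] [[u'' v''] w''].
congr (_, _, _) => /=; rewrite !hornerD !hornerZ -!mul_polyC; try by ring.
(* [drop_poly] is opaque to [ring], so its argument is first expanded and its linearity applied by
   hand. *)
rewrite (_ : _ * (_ + _) =
  c%:P * ((u + v) * (u' + v')) + (u + v) * (u'' + v'')); last by ring.
rewrite mul_polyC drop_polyD drop_polyZ -mul_polyC; ring.
Qed.

Lemma hw_mul_bilinear : bilinear_for *:%R *:%R hw_mul.
Proof.
split=> x; last exact: hw_mul_linear.
by move=> c y z; rewrite ![hw_mul _ x]hw_mulC hw_mul_linear.
Qed.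

HB.instance Definition _ :=
  bilinear_isBilinear.Build F P3 P3 P3 *:%R *:%R hw_mul hw_mul_bilinear.

Definition highwater : commNaAlgebra F := CommNaAlgebra hw_mulC.

(** * Adjoint map of the first axis and products of its eigenvectors *)

Definition axis0 : highwater := (1, 0, 0).
Definition axis1 : highwater := (0, 1, 0).

(** Splitting the first coordinate as c + X p separates the constant part, so the eigenvector
    equation becomes four independent comparisons. Here [l] is twice the eigenvalue. *)
Lemma ad_axis0P l c p v w :
  hw_mul2 axis0 (c%:P + 'X * p, v, w) = l *: (c%:P + 'X * p, v, w) :> P3 <->
  [/\ 2 * c + v.[0] = l * c, p + 3 * w = l *: p, v = l *: v
    & p + drop_poly 1 v + v + 3 * w = l *: w].
Proof.
have -> : hw_mul2 axis0 (c%:P + 'X * p, v, w) =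
  ((2 * c + v.[0])%:P + 'X * (p + 3 * w), v, p + drop_poly 1 v + v + 3 * w).
  rewrite /= !hornerSE; congr (_, _, _); try by ring.
  rewrite !(addr0, mulr0, mul1r, mul0r) !drop_polyD drop_poly1C drop_poly1MX.
  by ring.
have -> : l *: ((c%:P + 'X * p, v, w) : P3) =
  ((l * c)%:P + 'X * (l *: p), l *: v, l *: w).
  by congr (_, _, _); rewrite scalerDr scalerAr scale_polyC.
by split=> [[/poly_addCMX_inj[]]|[-> -> <- ->]].
Qed.

Definition eigvec0 p : highwater := (- 3 * 'X * p, 0, p).
Definition eigvec2 p : highwater := ('X * p, 0, p).
Definition eigvec_half p : highwater := (- (1 + 'X) * p, p, 0).

(** In each of the three families u + v is a multiple of X. Hence the values eps vanish and the
    quotient by X is explicit; the next five products follow in the same way. *)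
Lemma hw_mul2_00 p q :
  hw_mul2 (eigvec0 p) (eigvec0 q) = eigvec0 (6 * 'X * p * q).
Proof.
rewrite /= !hornerSE; congr (_, _, _); try by ring.
rewrite (_ : (_ + _) * _ = 'X * (9 * 'X * p * q)); last by ring.
by rewrite drop_poly1MX; ring.
Qed.

Lemma hw_mul2_02 p q :
  hw_mul2 (eigvec0 p) (eigvec2 q) = eigvec2 (- 6 * 'X * p * q).
Proof.
rewrite /= !hornerSE; congr (_, _, _); try by ring.
rewrite (_ : (_ + _) * _ = 'X * (- 3 * 'X * p * q)); last by ring.
by rewrite drop_poly1MX; ring.
Qed.

Lemma hw_mul2_22 p q :
  hw_mul2 (eigvec2 p) (eigvec2 q) = eigvec0 (- 2 * 'X * p * q).
Proof.
rewrite /= !hornerSE; congr (_, _, _); try by ring.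
rewrite (_ : (_ + _) * _ = 'X * ('X * p * q)); last by ring.
by rewrite drop_poly1MX; ring.
Qed.

Lemma hw_mul2_0h p q :
  hw_mul2 (eigvec0 p) (eigvec_half q) = eigvec_half (3 * 'X * p * q).
Proof.
rewrite /= !hornerSE; congr (_, _, _); try by ring.
rewrite (_ : (_ + _) * _ = 'X * (3 * 'X * p * q)); last by ring.
by rewrite drop_poly1MX; ring.
Qed.

Lemma hw_mul2_2h p q :
  hw_mul2 (eigvec2 p) (eigvec_half q) = eigvec_half (3 * 'X * p * q).
Proof.
rewrite /= !hornerSE; congr (_, _, _); try by ring.
rewrite (_ : (_ + _) * _ = 'X * (- 'X * p * q)); last by ring.
by rewrite drop_poly1MX; ring.
Qed.

Lemma hw_mul2_hh p q :
  hw_mul2 (eigvec_half p) (eigvec_half q) = (0, 0, - (2 + 'X) * p * q).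
Proof.
rewrite /= !hornerSE; congr (_, _, _); try by ring.
rewrite (_ : (_ + _) * _ = 'X * ('X * p * q)); last by ring.
by rewrite drop_poly1MX; ring.
Qed.

(** * Eigenspaces of the first axis in characteristic different from 2 and 3 *)

Hypotheses (char2 : 2%N \notin [pchar F]) (char3 : 3%N \notin [pchar F]).

Lemma two_neq0 : (2 : F) != 0.
Proof. by have := char2; rewrite inE. Qed.

Lemma three_neq0 : (3 : F) != 0.
Proof. by have := char3; rewrite inE. Qed.

Lemma four_neq0 : (4 : F) != 0.
Proof. by rewrite (_ : 4 = 2 * 2) ?mulf_neq0 ?two_neq0 //; ring. Qed.

Lemma mul2_half : 2 * (1 / 2) = 1 :> F.
Proof. by rewrite mulrC divfK ?two_neq0. Qed.

Lemma natr_poly_eq0 n p : n%:R != 0 :> F -> n%:R * p = 0 -> p = 0.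
Proof.
by move=> n0 /eqP; rewrite -polyC_natr mulf_eq0 polyC_eq0 (negbTE n0) => /eqP.
Qed.

Lemma scaler_id_eq0 l p : l != 1 -> p = l *: p -> p = 0.
Proof.
move=> l1 /eqP; rewrite -subr_eq0 -[X in X - _]scale1r -scalerBl scaler_eq0.
by rewrite subr_eq0 eq_sym (negbTE l1) => /eqP.
Qed.

(** Doubling the product doubles the eigenvalues: 1, 0, 2, 1/2 are seen as 2, 0, 4, 1. *)
Lemma in_eigenspace2 (a x : highwater) lam :
  in_eigenspace a lam x <-> hw_mul2 a x = (2 * lam) *: x.
Proof.
rewrite /in_eigenspace /= /hw_mul; split=> [e|->].
  by rewrite -scalerA -e scalerA divff ?scale1r ?two_neq0.
by rewrite scalerA mulKf ?two_neq0.
Qed.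

Lemma in_eigenspace_axis0P lam c p v w :
  in_eigenspace axis0 lam (c%:P + 'X * p, v, w) <->
  [/\ 2 * c + v.[0] = 2 * lam * c, p + 3 * w = (2 * lam) *: p,
      v = (2 * lam) *: v & p + drop_poly 1 v + v + 3 * w = (2 * lam) *: w].
Proof. by rewrite in_eigenspace2; exact: ad_axis0P. Qed.

Lemma eigenspace_axis0 : in_eigenspace axis0 1 axis0.
Proof.
rewrite {2}(_ : axis0 = (1%:P + 'X * 0, 0, 0)); last by rewrite mulr0 addr0.
apply/in_eigenspace_axis0P; split; rewrite ?scaler0 ?horner0 ?drop_poly0r; ring.
Qed.

Lemma eigenspace_eigvec0 p : in_eigenspace axis0 0 (eigvec0 p).
Proof.
rewrite (_ : eigvec0 p = (0%:P + 'X * (- 3 * p), 0, p)); last first.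
  by congr (_, _, _); ring.
apply/in_eigenspace_axis0P.
split; rewrite ?mulr0 ?scale0r ?horner0 ?drop_poly0r; ring.
Qed.

Lemma eigenspace_eigvec2 p : in_eigenspace axis0 2 (eigvec2 p).
Proof.
rewrite (_ : eigvec2 p = (0%:P + 'X * p, 0, p)); last by rewrite add0r.
apply/in_eigenspace_axis0P.
split; rewrite ?scaler0 ?horner0 ?drop_poly0r -?mul_polyC; ring.
Qed.

Lemma eigenspace_eigvec_half p : in_eigenspace axis0 (1 / 2) (eigvec_half p).
Proof.
rewrite (_ : eigvec_half p = ((- p.[0])%:P + 'X * (- drop_poly 1 p - p), p, 0)).
  by apply/in_eigenspace_axis0P; rewrite mul2_half !scale1r; split; ring.
congr (_, _, _); have e := drop_poly1E p; ring: e.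
Qed.

Lemma drop_poly1P p : exists c q, p = c%:P + 'X * q.
Proof. by exists p.[0], (drop_poly 1 p); exact: drop_poly1E. Qed.

Lemma eigenspace1P x :
  in_eigenspace (axis0 : highwater) 1 x <-> exists c, x = c *: axis0.
Proof.
split=> [|[c ->]]; last first.
  have e : na_mul _ axis0 axis0 = 1 *: axis0 := eigenspace_axis0.
  by rewrite /in_eigenspace linearZr_LR e !scale1r.
move: x => [[u v] w]; have [c [p ->]] := drop_poly1P u.
move=> /in_eigenspace_axis0P; rewrite mulr1 => -[_ e1].
have n21 : 2 != 1 :> F by rewrite -subr_eq0 (_ : 2 - 1 = 1) ?oner_neq0 //; ring.
move=> /(scaler_id_eq0 n21)->.
(* Once v = 0, the equations for p and w have the same left side p + 3 w, so p = w; then 4 w = 2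
   w. *)
rewrite drop_poly0r !addr0 e1 => /(scalerI two_neq0) epw.
move: e1; rewrite {}epw -mul_polyC => e1.
have w0 : w = 0.
  apply: (@natr_poly_eq0 2 _ two_neq0).
  rewrite (_ : 2 * w = w + 3 * w - 2%:P * w); first by rewrite e1 subrr.
  by ring.
exists c; rewrite w0 mulr0 addr0; congr (_, _, _); rewrite ?scaler0 //.
by rewrite /= alg_polyC.
Qed.

Lemma eigenspace0P x :
  in_eigenspace (axis0 : highwater) 0 x -> exists p, x = eigvec0 p.
Proof.
move: x => [[u v] w]; have [c [p ->]] := drop_poly1P u.
move=> /in_eigenspace_axis0P; rewrite !(mulr0, mul0r) !scale0r.
move=> [+ e1 v0 _]; rewrite {}v0 horner0 addr0 => /eqP.
rewrite mulf_eq0 (negbTE two_neq0) => /eqP->; exists w.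
have -> : p = - (3 * w) by apply/eqP; rewrite -addr_eq0 e1.
by congr (_, _, _); ring.
Qed.

Lemma eigenspace2P x :
  in_eigenspace (axis0 : highwater) 2 x -> exists p, x = eigvec2 p.
Proof.
move: x => [[u v] w]; have [c [p ->]] := drop_poly1P u.
move=> /in_eigenspace_axis0P-[e0 e1].
(* The equation v = 4 v forces v = 0 because 4 - 1 = 3 is invertible. *)
have n41 : 2 * 2 != 1 :> F.
  by rewrite -subr_eq0 (_ : 2 * 2 - 1 = 3) ?three_neq0 //; ring.
move=> /(scaler_id_eq0 n41) v0; move: e0; rewrite {}v0 horner0 addr0 => e0.
rewrite drop_poly0r !addr0 e1 => /(scalerI (mulf_neq0 two_neq0 two_neq0))->.
have /eqP : 2 * c = 0.
  rewrite (_ : 2 * c = 2 * 2 * c - 2 * c); first by rewrite -e0 subrr.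
  by ring.
by rewrite mulf_eq0 (negbTE two_neq0) => /eqP->; exists w; rewrite add0r.
Qed.

Lemma eigenspace_halfP x :
  in_eigenspace (axis0 : highwater) (1 / 2) x -> exists p, x = eigvec_half p.
Proof.
move: x => [[u v] w]; have [c [p ->]] := drop_poly1P u.
move=> /in_eigenspace_axis0P; rewrite mul2_half !scale1r mul1r => -[e0 e1 _].
have -> : w = 0.
  by apply: (@natr_poly_eq0 3 _ three_neq0); apply: (addrI p); rewrite addr0.
rewrite mulr0 addr0 => e2; exists v; congr (_, _, _).
have -> : c = - v.[0].
  apply/eqP; rewrite -addr_eq0 (_ : c + v.[0] = 2 * c + v.[0] - c).
    by rewrite e0 subrr.
  by ring.
have -> : p = - (drop_poly 1 v + v) by apply/eqP; rewrite -addr_eq0 addrA e2.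
have ev := drop_poly1E v; ring: ev.
Qed.

Lemma eigvec_decomp x :
  exists c p q v, x = c *: axis0 + eigvec0 p + eigvec2 q + eigvec_half v.
Proof.
(* The second coordinate forces the 1/2-part to be [eigvec_half v]. What remains is (c + X r, 0, w)
   with c = (u + v)(0), and the system q - 3 p = r, p + q = w gives 4 p = w - r. *)
move: x => [[u v] w]; pose r := drop_poly 1 (u + v) + v.
pose p := 4^-1 *: (w - r).
exists (u + v).[0], p, (w - p), v.
have e : 4 * p = w - r.
  by rewrite -polyC_natr mul_polyC scalerA divff ?scale1r ?four_neq0.
have euv := drop_poly1E (u + v).
congr (_, _, _); rewrite /= ?scaler0; try by ring.
rewrite alg_polyC; apply: (addIr v); rewrite {1}euv.
rewrite (_ : drop_poly 1 (u + v) = w - 4 * p - v); first by ring.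
by rewrite e /r; ring.
Qed.

(** Each excluded value removes one unknown: lam != 1/2 gives v = 0, lam != 1 gives c = 0, lam != 0
    gives p = w, and then 4 w = 2 lam w with lam != 2 gives w = 0. *)
Lemma axis0_spectrum lam :
  ad_eigenvalue (axis0 : highwater) lam -> lam \in monster_spectrum 2 (1 / 2).
Proof.
move=> [[[u v] w] x0]; have [c [p ep]] := drop_poly1P u; move: x0.
rewrite {}ep => x0 /in_eigenspace_axis0P[e0 e1 ev e2].
rewrite !inE; apply: contraNT x0; rewrite !negb_or => /and4P[l1 l0 l2 lh].
have n1 : 2 * lam != 1.
  by apply: contra_neq lh => e; apply: (mulfI two_neq0); rewrite e mul2_half.
have {n1} v0 := scaler_id_eq0 n1 ev.
have c0 : c = 0.
  have: (2 * (1 - lam)) * c = 0.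
    by rewrite mulrBr mulr1 mulrBl -e0 v0 horner0 addr0 subrr.
  move=> /eqP; rewrite !mulf_eq0 (negbTE two_neq0) subr_eq0 eq_sym (negbTE l1).
  by move=> /eqP.
have pw : p = w.
  apply: (scalerI (mulf_neq0 two_neq0 l0)).
  by rewrite -e1 -e2 v0 drop_poly0r !addr0.
have w0 : w = 0.
  move: e1; rewrite pw => e1; apply/eqP.
  have: (2 * (2 - lam)) *: w = 0.
    by rewrite mulrBr scalerBl -e1 -mul_polyC; ring.
  by move=> /eqP; rewrite scaler_eq0 mulf_eq0 (negbTE two_neq0) subr_eq0
    eq_sym (negbTE l2).
by rewrite c0 pw w0 v0 mulr0 addr0.
Qed.

(** * Fusion law of the first axis *)

Lemma monster_parameters_half : monster_parameters (2 : F) (1 / 2).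
Proof.
have half2 := inj_eq (mulfI two_neq0).
split; rewrite ?inE ?negb_or ?two_neq0 /=.
- by rewrite -subr_eq0 (_ : 2 - 1 = 1) ?oner_neq0 //; ring.
- rewrite -half2 mul2_half mulr0 oner_neq0 /= -half2 mul2_half mulr1.
  by rewrite eq_sym -subr_eq0 (_ : 2 - 1 = 1) ?oner_neq0 //; ring.
by rewrite -half2 mul2_half -subr_eq0 (_ : _ - _ = 3) ?three_neq0 //; ring.
Qed.

Lemma hw_eigen_sum P c x y :
  hw_mul2 x y = c -> eigen_sum (axis0 : highwater) P c ->
  eigen_sum axis0 P (na_mul highwater x y).
Proof.
by move=> e ec; rewrite /= /hw_mul e; apply: (@eigen_sumZ _ highwater).
Qed.

Lemma axis0_is_axis : is_axis (monster_law 2 (1 / 2)) (axis0 : highwater).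
Proof.
split.
- split; first by apply/eqP => -[/eqP]; rewrite oner_eq0.
  by have := eigenspace_axis0; rewrite /in_eigenspace scale1r.
- move=> x; have [c [p [q [v ->]]]] := eigvec_decomp x.
  do ![apply: (@eigen_sumD _ highwater)].
  + by apply: (@eigen_sumZ _ highwater); apply: eigen_sum1 eigenspace_axis0.
  + exact: eigen_sum1 (eigenspace_eigvec0 p).
  + exact: eigen_sum1 (eigenspace_eigvec2 q).
  + exact: eigen_sum1 (eigenspace_eigvec_half v).
- exact: axis0_spectrum.
have [s00 s02 s0h [s22 s2h shh s1]] := monster_starE monster_parameters_half.
pose fus lam mu := forall u v : highwater,
  in_eigenspace axis0 lam u -> in_eigenspace axis0 mu v ->
  eigen_sum axis0 (fun del => del \in monster_star 2 (1 / 2) lam mu)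
    (na_mul highwater u v).
have fusC lam mu : fus lam mu -> fus mu lam.
  by move=> f u v au av; rewrite monster_starC na_mulC; apply: f.
(* A 1-eigenvector is a multiple of the axis, so it only rescales the other factor, and annihilates
   it when lam = 0. *)
have fus1 lam : lam \in [:: 1; 0; 2; 1 / 2] -> fus 1 lam.
  move=> lamS u v /eigenspace1P[c ->] av; rewrite linearZl_LR.
  apply: (@eigen_sumZ _ highwater); rewrite s1 // av.
  have [->|l0] := eqVneq lam 0; first by rewrite scale0r; exact: eigen_sum0.
  apply: (@eigen_sumZ _ highwater); apply: eigen_sum1 av; exact: mem_head.
have fus00 : fus 0 0.
  move=> _ _ /eigenspace0P[p ->] /eigenspace0P[q ->].
  apply: hw_eigen_sum (hw_mul2_00 p q) _;
    apply: eigen_sum1 (eigenspace_eigvec0 _).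
  by rewrite s00 !inE eqxx.
have fus02 : fus 0 2.
  move=> _ _ /eigenspace0P[p ->] /eigenspace2P[q ->].
  apply: hw_eigen_sum (hw_mul2_02 p q) _;
    apply: eigen_sum1 (eigenspace_eigvec2 _).
  by rewrite s02 !inE eqxx.
have fus0h : fus 0 (1 / 2).
  move=> _ _ /eigenspace0P[p ->] /eigenspace_halfP[q ->].
  apply: hw_eigen_sum (hw_mul2_0h p q) _;
    apply: eigen_sum1 (eigenspace_eigvec_half _).
  by rewrite s0h !inE eqxx.
have fus22 : fus 2 2.
  move=> _ _ /eigenspace2P[p ->] /eigenspace2P[q ->].
  apply: hw_eigen_sum (hw_mul2_22 p q) _;
    apply: eigen_sum1 (eigenspace_eigvec0 _).
  by rewrite s22 !inE eqxx orbT.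
have fus2h : fus 2 (1 / 2).
  move=> _ _ /eigenspace2P[p ->] /eigenspace_halfP[q ->].
  apply: hw_eigen_sum (hw_mul2_2h p q) _;
    apply: eigen_sum1 (eigenspace_eigvec_half _).
  by rewrite s2h !inE eqxx.
have fushh : fus (1 / 2) (1 / 2).
  move=> _ _ /eigenspace_halfP[p ->] /eigenspace_halfP[q ->].
  apply: hw_eigen_sum (hw_mul2_hh p q) _; rewrite shh.
  set w := _ * q.
  (* The first coordinate of [eigvec0 p + eigvec2 q] is X (q - 3 p); it vanishes for q = 3 p, so w
     splits as w/4 and 3w/4. *)
  have -> : (0, 0, w) = eigvec0 (4^-1 *: w) + eigvec2 (w - 4^-1 *: w).
    have e : 4 * (4^-1 *: w) = w.
      by rewrite -polyC_natr mul_polyC scalerA divff ?scale1r ?four_neq0.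
    congr (_, _, _); rewrite /= ?addr0 //; last by ring.
    by rewrite -{2}e; ring.
  apply: (@eigen_sumD _ highwater).
  + by apply: eigen_sum1 (eigenspace_eigvec0 _); rewrite !inE eqxx orbT.
  + by apply: eigen_sum1 (eigenspace_eigvec2 _); rewrite !inE eqxx !orbT.
move=> lam mu u v lamS muS; move: lamS muS u v.
rewrite /= [lam \in _]inE => /predU1P[->|lamS]; first exact: fus1.
rewrite [mu \in _]inE => /predU1P[->|].
  by apply: fusC; apply: fus1; rewrite inE lamS orbT.
(* Of the nine remaining pairs, six are treated above and three are their mirror images. *)
move: lamS; rewrite !inE => /or3P[]/eqP-> /or3P[]/eqP-> //; exact: fusC.
Qed.

Lemma axis0_primitive : primitive_axis (axis0 : highwater).
Proof. exact: eigenspace1P. Qed.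

(** * The automorphism exchanging the two axes *)

Definition swap (x : highwater) : highwater := (x.1.2, x.1.1, x.2).

Lemma swap_linear : linear swap.
Proof. by []. Qed.

HB.instance Definition _ :=
  GRing.isLinear.Build F highwater highwater *:%R swap swap_linear.

Lemma swapK : involutive swap.
Proof. by move=> [[]]. Qed.

Lemma swapM : {morph swap : x y / na_mul highwater x y}.
Proof.
move=> [[u v] w] [[u' v'] w']; rewrite /= /hw_mul linearZ; congr (_ *: _).
congr (_, _, _) => /=; try by ring.
by rewrite [v + u]addrC [v' + u']addrC; ring.
Qed.

(** * Generation by the two axes *)

Local Notation axes := (fun x : highwater => x = axis0 \/ x = axis1).

Lemma hw_mul2_axis0 p : hw_mul2 axis0 (0, 0, p) = (3 * 'X * p, 0, 3 * p).
Proof.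
rewrite /= !hornerSE; congr (_, _, _); try by ring.
by rewrite !addr0 mulr0 drop_poly0r; ring.
Qed.

Lemma hw_mul2_axis1 p : hw_mul2 axis1 (0, 0, p) = (0, 3 * 'X * p, 3 * p).
Proof.
rewrite /= !hornerSE; congr (_, _, _); try by ring.
by rewrite !addr0 mulr0 drop_poly0r; ring.
Qed.

Lemma hw_mul2_MX_axis1 p :
  hw_mul2 (p * 'X, 0, 0) axis1 = (p * 'X, 0, p + p * 'X).
Proof.
rewrite /= !hornerSE; congr (_, _, _); try by ring.
by rewrite addr0 add0r mulr1 mulrC drop_poly1MX; ring.
Qed.

Lemma generated_hw_mul2 (A : highwater -> Prop) (x y : highwater) :
  generated A x -> generated A y -> generated A (hw_mul2 x y : highwater).
Proof.
move=> Ax Ay; have -> : hw_mul2 x y = 2 *: hw_mul x y.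
  by rewrite /hw_mul scalerA divff ?scale1r ?two_neq0.
by apply: (@generatedZ _ highwater); apply: (@generatedM _ highwater).
Qed.

Lemma generated_highwater (x : highwater) : generated axes x.
Proof.
have g0 : generated axes axis0 by apply: generated_mem; left.
have g1 : generated axes axis1 by apply: generated_mem; right.
have gB (x1 x2 : highwater) :
    generated axes x1 -> generated axes x2 -> generated axes (x1 - x2).
  by move=> g2 g3; rewrite -scaleN1r addrC; apply: (@generatedP _ highwater).
pose s : highwater := (0, 0, 1).
have gs : generated axes s.
  (* Twice the product of the axes is (1, 1, 1). *)
  have -> : s = (hw_mul2 axis0 axis1 : highwater) - (axis0 + axis1).
    rewrite /= !hornerSE; congr (_, _, _) => /=; try by ring.
    by rewrite !(add0r, addr0, mulr1) drop_poly1C; ring.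
  by apply: gB; [apply: generated_hw_mul2|apply: (@generatedD _ highwater)].
have K3 p : 3^-1 *: (3 * p) = p.
  by rewrite -polyC_natr mul_polyC scalerA mulVf ?scale1r ?three_neq0.
have g p : [/\ generated axes ((p, 0, 0) : highwater),
    generated axes ((0, p, 0) : highwater)
  & generated axes ((0, 0, p) : highwater)].
  (* Induction on p -> p X + c: multiplying (0, 0, p) by either axis yields the factor X in that
     axis's coordinate, and [axis0], [axis1], [s] supply the constants c. *)
  elim/poly_ind: p => [|p c [_ _ gp]].
    by split; exact: (@generated0 _ highwater).
  pose wp : highwater := (0, 0, p).
  have gu : generated axes ((p * 'X, 0, 0) : highwater).
    have -> : (p * 'X, 0, 0) =
        3^-1 *: ((hw_mul2 axis0 wp : highwater) - 3 *: wp).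
      rewrite hw_mul2_axis0; congr (_, _, _).
      - by rewrite /= scaler0 subr0 -mulrA K3 mulrC.
      - by rewrite /= scaler0 subr0 scaler0.
      by rewrite /= -[3 *: p]mul_polyC polyC_natr subrr scaler0.
    apply: (@generatedZ _ highwater); apply: gB; first exact: generated_hw_mul2.
    exact: (@generatedZ _ highwater).
  have gv : generated axes ((0, p * 'X, 0) : highwater).
    have -> : (0, p * 'X, 0) =
        3^-1 *: ((hw_mul2 axis1 wp : highwater) - 3 *: wp).
      rewrite hw_mul2_axis1; congr (_, _, _).
      - by rewrite /= scaler0 subr0 scaler0.
      - by rewrite /= scaler0 subr0 -mulrA K3 mulrC.
      by rewrite /= -[3 *: p]mul_polyC polyC_natr subrr scaler0.
    apply: (@generatedZ _ highwater); apply: gB; first exact: generated_hw_mul2.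
    exact: (@generatedZ _ highwater).
  (* Multiplying the new element (p X, 0, 0) by the other axis brings p X into the third
     coordinate. *)
  have gw : generated axes ((0, 0, p * 'X) : highwater).
    have -> : (0, 0, p * 'X) =
        (hw_mul2 (p * 'X, 0, 0) axis1 : highwater) - ((p * 'X, 0, 0) + wp).
      by rewrite hw_mul2_MX_axis1; congr (_, _, _) => /=; ring.
    by apply: gB; [apply: generated_hw_mul2|apply: (@generatedD _ highwater)].
  rewrite -[c%:P]alg_polyC; split.
  - rewrite (_ : (_, _, _) = c *: axis0 + (p * 'X, 0, 0)); last first.
      by congr (_, _, _); rewrite /= ?scaler0 ?addr0 // addrC.
    exact: (@generatedP _ highwater).
  - rewrite (_ : (_, _, _) = c *: axis1 + (0, p * 'X, 0)); last first.
      by congr (_, _, _); rewrite /= ?scaler0 ?addr0 // addrC.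
    exact: (@generatedP _ highwater).
  - rewrite (_ : (_, _, _) = c *: s + (0, 0, p * 'X)); last first.
      by congr (_, _, _); rewrite /= ?scaler0 ?addr0 // addrC.
    exact: (@generatedP _ highwater).
move: x => [[u v] w].
rewrite (_ : (u, v, w) = (u, 0, 0) + (0, v, 0) + (0, 0, w)); last first.
  by congr (_, _, _); rewrite /= ?addr0 ?add0r.
have [[gu _ _] [_ gv _] [_ _ gw]] := And3 (g u) (g v) (g w).
by apply: (@generatedD _ highwater) => //; apply: (@generatedD _ highwater).
Qed.

(** * Infinite dimension *)

Lemma highwater_infinite : ~ finite_dimensional highwater.
Proof.
move=> [n [e e_span]].
(* Size is degree plus one, so the first coordinates of all [e i] have zero coefficient at index m,
   unlike X^m. *)
pose m := \max_(i < n) size (e i).1.1.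
have [c] := e_span (('X^m, 0, 0) : highwater).
move=> /(congr1 (fun x : P3 => x.1.1`_m)) /=; rewrite coefXn eqxx.
have -> : (\sum_(i < n) c i *: e i).1.1 = \sum_(i < n) c i *: (e i).1.1.
  exact: (big_morph (fun x : P3 => x.1.1)).
rewrite coef_sum big1 => [/eqP|i _]; first by rewrite oner_eq0.
rewrite coefZ nth_default ?mulr0 //.
exact: (leq_bigmax i).
Qed.

End Highwater.

Theorem theorem1p1 (F : fieldType)
    (char2 : 2%N \notin [pchar F]) (char3 : 3%N \notin [pchar F]) :
  exists V : commNaAlgebra F,
    two_generated_primitive_monster (2 : F) (1 / 2 : F) V
    /\ ~ finite_dimensional V.
Proof.
exists (highwater F); split; last exact: highwater_infinite.
split; first exact: monster_parameters_half.
(* The second axis is the image of the first under an automorphism, so its axis and primitivity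
   conditions need no new computation. *)
have axis1E : axis1 F = swap (axis0 F) by [].
exists (axis0 F), (axis1 F); split.
  by apply/eqP => -[/eqP]; rewrite oner_eq0.
split; first split.
- move=> a [->|->]; first exact: axis0_is_axis.
  rewrite axis1E; apply: (is_axis_aut (@swapK F) (@swapM F)).
  exact: axis0_is_axis.
- exact: generated_highwater.
move=> a [->|->]; first exact: axis0_primitive.
rewrite axis1E; apply: (primitive_axis_aut (@swapK F) (@swapM F)).
exact: axis0_primitive.
Qed.
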